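(* Assume the Continuum Hypothesis ($2^{\aleph_0}=\aleph_1$). Then every productively Lindelöf $T_3$ space is a $D$-space.
   Context: All topological spaces are assumed to be $T_3$ (regular and Hausdorff). A space $X$ is productively Lindelöf if $X\times Y$ is Lindelöf for every Lindelöf space $Y$. A space $X$ is a $D$-space if for every assignment $f$ sending each point $x\in X$ to an open neighborhood $f(x)$ of $x$, there is a closed discrete $D\subseteq X$ such that $\{f(x):x\in D\}$ covers $X$. *)

(* Defs.v *)
From HB Require Import structures.
From mathcomp Require Import all_boot all_order.
From mathcomp Require Import boolp classical_sets functions cardinality.
From mathcomp Require Import topology.

Set Implicit Arguments.
Unset Strict Implicit.
Unset Printing Implicit Defensive.

Local Open Scope classical_set_scope.
Local Open Scope card_scope.

(* [regular_space] alone does not include any separation of points. *)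
Definition T3_space (X : topologicalType) : Prop :=
  regular_space X /\ hausdorff_space X.

Definition lindelof (X : topologicalType) : Prop :=
  forall U : set (set X),
    (forall A, U A -> open A) ->
    \bigcup_(A in U) A = [set: X] ->
    exists V : set (set X),
      [/\ V `<=` U, countable V & \bigcup_(A in V) A = [set: X]].

(* All spaces are assumed to be T3, hence the test spaces Y are, too. *)
Definition productively_lindelof (X : topologicalType) : Prop :=
  forall Y : topologicalType,
    T3_space Y -> lindelof Y -> lindelof (X * Y)%type.

(* [D] is discrete in its subspace topology iff each of its points is isolated
   in [D]. *)
Definition closed_discrete (X : topologicalType) (D : set X) : Prop :=
  closed D /\ D `<=` isolated D.

Definition D_space (X : topologicalType) : Prop :=
  forall f : X -> set X,
    (forall x, open (f x) /\ f x x) ->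
    exists D : set X,
      closed_discrete D /\ \bigcup_(x in D) f x = [set: X].

(* [A] has cardinality aleph_1, the least uncountable cardinal. *)
Definition has_card_aleph1 (T : Type) (A : set T) : Prop :=
  ~ countable A /\
  forall (U : Type) (B : set U), ~ countable B -> A #<= B.

Definition continuum_hypothesis : Prop := has_card_aleph1 [set: set nat].

(* Main.v *)
Require Import Defs.
From HB Require Import structures.
From mathcomp Require Import all_boot all_order.
From mathcomp Require Import boolp classical_sets functions cardinality.
From mathcomp Require Import topology.
From mathcomp Require Import wochoice.

Set Implicit Arguments.
Unset Strict Implicit.
Unset Printing Implicit Defensive.

Local Open Scope classical_set_scope.
Local Open Scope card_scope.

(** Let [f] be a neighbourhood assignment on a productively Lindelof space [X].

Consider building a closed discrete set in countably many rounds.  At each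
round there is a finite set [D], and [cov D], the union of the [f x] for
[x \in D], is open.  As [X] is Lindelof, [~` cov D] is covered by the [f x]
for [x] in an increasing sequence of finite sets [E D n], all disjoint from
[cov D] ([lindelof_finite_exhaustion]); for the next round choose [n] and add
[E D n] to [D].  The possible positions form a tree indexed by finite sequences
of numbers.  If along some branch the sets [cov D] exhaust [X], then the union
of the sets [D] along that branch is as required: every point is in some
[cov D], and points added later avoid that open set, so the union is locally
finite.

It remains to find such a branch, which is
[productively_lindelof_covering_branch]: the open sets [V s] attached to the
nodes [s] have the property that [V (rcons s n)] increases with [n] and exhausts
[X].  Suppose that every branch [b] leaves uncovered some point of [X].  The
pairs (point, branch leaving it uncovered) form a relation which projects onto
all of the Baire space, and this is turned against the Lindelof property of the
product of [X] with a test space that plays the role of a Michael line.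

The test space [broom a] consists of all finite sequences together with an
uncountable family [a] of branches.  Branches are isolated, and a neighbourhood
of [s] contains all that extends [rcons s n], for all large [n]; so these
cones converge to [s].  The space is T3 for every [a]
([broom_T3]).  It is Lindelof as soon as, for every bound [N] on finite
sequences, all but countably many of the branches violate [N] at some node
([broom_lindelof]); under the Continuum Hypothesis a diagonalization of length
[omega_1] over all bounds produces such a family ([CH_escaping_family]).  Now
the product of [X] with [broom a] is covered by the slices of [X] over the
isolated points, together with open rectangles that miss the relation above: at
[(x, s)] take [V (rcons s N)] with [x] in it, times a small enough neighbourhood
of [s].  A countable subcover contains only countably many slices, hence misses
a pair of the relation over some branch of the family. *)

(** * Countable sets *)

Lemma countable_setU T (A B : set T) :
  countable A -> countable B -> countable (A `|` B).
Proof.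
move=> cA cB; rewrite (_ : A `|` B = \bigcup_(b : bool) (if b then A else B)).
  by apply: bigcup_countable => // -[].
apply/seteqP; split=> [x [Ax|Bx]|x [[] _ /=]];
  by [exists true|exists false|left|right].
Qed.

Lemma countable_preimage_inj T U (f : T -> U) (A : set U) :
  injective f -> countable A -> countable (f @^-1` A).
Proof.
move=> finj /countable_injP[g ginj]; apply/countable_injP; exists (g \o f).
move=> x y; rewrite !inE => Ax Ay /= /ginj.
rewrite !inE => /(_ Ax Ay); exact: finj.
Qed.

(** * The Continuum Hypothesis and a family of branches escaping every bound *)

(** A well-order of the continuum may have uncountable proper initial segments;
then the first of them has only countable ones inside it, and by the Continuum
Hypothesis it has room for a copy of the continuum. *)
Lemma CH_injection_countable_segments (R : rel (set nat)) :
  continuum_hypothesis -> well_order R ->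
  exists2 f : set nat -> set nat, injective f &
    forall t, countable [set s | ~~ R (f t) s].
Proof.
move=> [_ CH] woR.
have [?|/existsNP[t0 ct0]] := pselect (forall t, countable [set s | ~~ R t s]).
  by exists id.
have [|t [[/asboolP ct tmin] _]] :=
  woR [pred t | `[< ~ countable [set s | ~~ R t s] >]].
  by exists t0; apply/asboolP.
have /pcard_leP[f] := CH _ _ ct.
exists f => [x y|x]; first by apply: (@inj _ _ _ f); rewrite inE.
have /= Rtfx : ~~ R t (f x) by exact: (@funS _ _ _ _ f).
apply: contrapT => nc; move/negP: Rtfx; apply; apply: tmin.
exact/asboolP.
Qed.

(** [S] is a strict order of type [omega_1].  Only the countability of its
initial segments and of the complements of its final segments is recorded,
which is what a diagonalization of length [omega_1] relies on. *)
Lemma CH_countable_segments : continuum_hypothesis ->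
  exists S : set nat -> set nat -> Prop,
    (forall i, countable [set j | S j i]) /\
    (forall j, countable [set i | ~ S j i]).
Proof.
move=> CH; have [R woR] := well_ordering_principle (set nat).
have [f finj cf] := CH_injection_countable_segments CH woR.
exists (fun j i => ~~ R (f i) (f j)); split=> [i|j].
  exact: (countable_preimage_inj finj (cf i)).
pose B := f @^-1` [set s | ~~ R (f j) s] `|` [set j].
apply: (@sub_countable _ _ _ B); last first.
  by apply: countable_setU => //; exact: countable_preimage_inj.
apply: subset_card_le => i /= /negP; rewrite negbK => Rij.
have [Rji|] := boolP (R (f j) (f i)); last by left.
right; apply: finj; apply: (wo_chain_antisymmetric (C := predT)) => //.
  by move=> A _; exact: woR.
by rewrite Rij Rji.
Qed.

(** Sets of numbers enumerate all functions on finite sequences: [j] is read as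
the graph of a function, the value being arbitrary where [j] does not
determine it. *)
Definition coded_bound (j : set nat) (s : seq nat) : nat :=
  xget 0 [set n | j (pickle (s, n))].

Lemma coded_bound_surj (N : seq nat -> nat) : exists j, coded_bound j = N.
Proof.
exists (range (fun s => pickle (s, N s))); apply/funext => s.
rewrite /coded_bound; case: xgetP => [n _ [t _ /(pcan_inj pickleK)[-> ->//]]|].
by move=> /(_ (N s)) []; exists s.
Qed.

Lemma diagonal_branch (F : nat -> seq nat -> nat) :
  exists a : nat -> nat, forall k, F k (mkseq a k) <= a k.
Proof.
pose s k := iteri k (fun k t => rcons t (F k t)) [::].
pose a k := F k (s k).
have sE k : mkseq a k = s k by elim: k => // k IH; rewrite mkseqS IH.
by exists a => k; rewrite sE.
Qed.

(** The branch with index [i] is made to violate the countably many bounds coded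
below [i]; so the branches that respect the bound coded by [j] have their
indices in the countable set that is not above [j]. *)
Lemma CH_escaping_family : continuum_hypothesis ->
  exists a : set nat -> nat -> nat,
    forall N, countable [set i | forall n, a i n < N (mkseq (a i) n)].
Proof.
move=> /CH_countable_segments[S [cS1 cS2]].
have esc i : exists b : nat -> nat, forall j, S j i ->
    exists n, coded_bound j (mkseq b n) <= b n.
  have /pcard_surjP[e esurj] := cS1 i.
  have [b bP] := diagonal_branch (coded_bound \o e).
  by exists b => j /esurj[k _ <-]; exists k; exact: bP.
have [a aP] := choice esc.
exists a => N; have [j <-] := coded_bound_surj N.
apply: (sub_countable _ (cS2 j)); apply: subset_card_le => i /= caught Sji.
by have [n] := aP i j Sji; rewrite leqNgt caught.
Qed.

(** * The broom space of a family of branches *)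

(** A separate name for the sum type, to carry a topology other than that of a
sum and depending on [a]. *)
Definition broom (I : choiceType) (a : I -> nat -> nat) : Type :=
  (seq nat + I)%type.

HB.instance Definition _ (I : choiceType) (a : I -> nat -> nat) :=
  Choice.copy (broom a) (seq nat + I)%type.

Definition node (I : choiceType) (a : I -> nat -> nat) (s : seq nat) :
    broom a := inl s.
Definition leaf (I : choiceType) (a : I -> nat -> nat) (i : I) :
    broom a := inr i.

Arguments node {I} a s.
Arguments leaf {I} a i.

(** Nodes and leaves as partial sequences, so that one notion of extension,
[cylinder], serves both. *)
Definition digit (I : choiceType) (a : I -> nat -> nat) (y : broom a)
    (k : nat) : option nat :=
  match y with inl s => onth s k | inr i => Some (a i k) end.

Definition cylinder (I : choiceType) (a : I -> nat -> nat) (s : seq nat) :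
    set (broom a) :=
  [set y | forall k, k < size s -> digit y k = Some (nth 0 s k)].

Arguments cylinder {I} a s.

Lemma cylinder_rcons (I : choiceType) (a : I -> nat -> nat) (s : seq nat) n
    (y : broom a) :
  cylinder a (rcons s n) y <-> cylinder a s y /\ digit y (size s) = Some n.
Proof.
split=> [ys|[ys yn] k].
  split=> [k ks|]; last first.
    by rewrite (ys (size s)) ?size_rcons// nth_rcons ltnn eqxx.
  by rewrite ys ?size_rcons 1?ltnW// nth_rcons ks.
rewrite size_rcons ltnS leq_eqVlt => /predU1P[->|ks].
  by rewrite nth_rcons ltnn eqxx.
by rewrite nth_rcons ks ys.
Qed.

Lemma cylinder_node (I : choiceType) (a : I -> nat -> nat) (s : seq nat) :
  cylinder a s (node a s).
Proof. by move=> k ks; rewrite /= onthE (nth_map 0). Qed.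

Lemma cylinder_leaf (I : choiceType) (a : I -> nat -> nat) i n :
  cylinder a (mkseq (a i) n) (leaf a i).
Proof. by move=> k; rewrite size_mkseq => kn; rewrite /= nth_mkseq. Qed.

Lemma cylinder_leafP (I : choiceType) (a : I -> nat -> nat) i (s : seq nat) :
  cylinder a s (leaf a i) -> mkseq (a i) (size s) = s.
Proof.
move=> si; apply: (@eq_from_nth _ 0); rewrite size_mkseq// => k ks.
by rewrite nth_mkseq//; have [] := si k ks.
Qed.

(** A branch never stops, so the only element of a cylinder without a further
digit is the node that defines the cylinder. *)
Lemma cylinder_stop (I : choiceType) (a : I -> nat -> nat) (s : seq nat)
    (y : broom a) :
  cylinder a s y -> digit y (size s) = None -> y = node a s.
Proof.
case: y => [t|//] st /eqP; rewrite -[_ == None]negbK -/(isSome _) => /= tN.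
have ts : size t <= size s by rewrite -onthNE; case: onth tN.
congr inl; have sz : size t = size s.
  apply/eqP; rewrite eqn_leq ts leqNgt; apply/negP => lt.
  by have := st _ lt; rewrite /= onth_default.
by apply: (@eq_from_nth _ 0) => // k; rewrite sz => /st /(onth_nth 0 _ _ _).
Qed.

Lemma cylinder_trans (I : choiceType) (a : I -> nat -> nat) (s t : seq nat)
    (y : broom a) :
  cylinder a s (node a t) -> cylinder a t y -> cylinder a s y.
Proof.
move=> st ty k ks; have /= tk := st k ks.
have kt : k < size t by rewrite -onthTE tk.
by rewrite ty// (onth_nth 0 _ _ _ tk).
Qed.

(** The cones above the immediate successors of a node converge to it; leaves
are isolated. *)
Definition broom_open (I : choiceType) (a : I -> nat -> nat)
    (U : set (broom a)) : Prop :=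
  forall s, U (node a s) ->
    exists N, forall n, N <= n -> cylinder a (rcons s n) `<=` U.

Lemma broom_openT (I : choiceType) (a : I -> nat -> nat) :
  broom_open (@setT (broom a)).
Proof. by move=> s _; exists 0. Qed.

Lemma broom_openI (I : choiceType) (a : I -> nat -> nat) :
  setI_closed (@broom_open I a).
Proof.
move=> U V oU oV s [/oU[M UM] /oV[N VN]]; exists (maxn M N) => n.
by rewrite geq_max => /andP[Mn Nn] y yn; split; [exact: UM yn|exact: VN yn].
Qed.

Lemma broom_open_bigU (I : choiceType) (a : I -> nat -> nat) (J : Type)
    (U : J -> set (broom a)) :
  (forall j, broom_open (U j)) -> broom_open (\bigcup_j U j).
Proof.
by move=> oU s [j _ /oU[N UN]]; exists N => n Nn y /(UN n Nn) Uy; exists j.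
Qed.

HB.instance Definition _ (I : choiceType) (a : I -> nat -> nat) :=
  isOpenTopological.Build (broom a) (@broom_openT I a) (@broom_openI I a)
    (@broom_open_bigU I a).

Lemma open_broomE (I : choiceType) (a : I -> nat -> nat) (U : set (broom a)) :
  open U = broom_open U.
Proof. by []. Qed.

Lemma open_cylinder (I : choiceType) (a : I -> nat -> nat) (s : seq nat) :
  open (cylinder a s).
Proof.
rewrite open_broomE => t st; exists 0 => n _ y /cylinder_rcons[ty _].
exact: cylinder_trans ty.
Qed.

(** If [t] lies outside the cylinder of [s], at most one immediate successor of
[t] leads into it, so the successors with larger last digit avoid it. *)
Lemma closed_cylinder (I : choiceType) (a : I -> nat -> nat) (s : seq nat) :
  closed (cylinder a s).
Proof.
rewrite -[cylinder a s]setCK; apply: open_closedC; rewrite open_broomE => t st.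
exists (nth 0 s (size t)).+1 => n tn y /cylinder_rcons[ty yn] sy.
have [lt|le] := ltnP (size t) (size s).
  by move: (sy _ lt) tn; rewrite yn => -[->]; rewrite ltnn.
apply: st => k ks; have kt := leq_trans ks le.
by rewrite (cylinder_node a kt) -(ty k kt) (sy k ks).
Qed.

Lemma closed_broom1 (I : choiceType) (a : I -> nat -> nat) (y : broom a) :
  closed [set y].
Proof.
rewrite -[[set y]]setCK; apply: open_closedC; rewrite open_broomE => t _.
exists (odflt 0 (digit y (size t))).+1 => n tn z /cylinder_rcons[_ zn] zy.
by move: tn; rewrite -zy zn /= ltnn.
Qed.

Lemma open_leaf (I : choiceType) (a : I -> nat -> nat) (i : I) :
  open [set leaf a i].
Proof. by rewrite open_broomE. Qed.

(** The basic neighbourhoods of the node [s].  Cutting finitely many cylinders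
out of a cylinder makes it evident that they are closed; [fanP] gives the form
in which they are neighbourhoods. *)
Definition fan (I : choiceType) (a : I -> nat -> nat) (s : seq nat) (N : nat) :
    set (broom a) :=
  cylinder a s `&` \bigcap_(n in [set n | n < N]) ~` cylinder a (rcons s n).

Arguments fan {I} a s N.

Lemma fan_node (I : choiceType) (a : I -> nat -> nat) (s : seq nat) N :
  fan a s N (node a s).
Proof.
split=> [|n _ /cylinder_rcons[_]]; first exact: cylinder_node.
by rewrite /= onth_default.
Qed.

Lemma fanP (I : choiceType) (a : I -> nat -> nat) (s : seq nat) N
    (y : broom a) :
  fan a s N y <-> y = node a s \/ exists2 n, N <= n & cylinder a (rcons s n) y.
Proof.
split=> [[sy NCy]|[->|[n Nn]]]; last 2 first.
- exact: fan_node.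
- move=> /cylinder_rcons[sy yn]; split=> // m /= mN /cylinder_rcons[_].
  by rewrite yn => -[nm]; rewrite -nm ltnNge Nn in mN.
case yn : (digit y (size s)) => [n|]; last by left; exact: cylinder_stop.
have sny : cylinder a (rcons s n) y by exact/cylinder_rcons.
by right; exists n => //; rewrite leqNgt; apply/negP => /NCy.
Qed.

Lemma open_fan (I : choiceType) (a : I -> nat -> nat) (s : seq nat) N :
  open (fan a s N).
Proof.
rewrite open_broomE => t /fanP[[<-]|[n Nn snt]].
  by exists N => n Nn y ny; apply/fanP; right; exists n.
exists 0 => m _ y /cylinder_rcons[ty _]; apply/fanP; right; exists n => //.
exact: cylinder_trans ty.
Qed.

Lemma closed_fan (I : choiceType) (a : I -> nat -> nat) (s : seq nat) N :
  closed (fan a s N).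
Proof.
apply: closedI; first exact: closed_cylinder.
apply: closed_bigI => n _; apply: open_closedC; exact: open_cylinder.
Qed.

Lemma clopen_base_T3 (Y : topologicalType) :
  (forall y : Y, closed [set y]) ->
  (forall (U : set Y) y, open U -> U y ->
    exists W : set Y, [/\ open W, closed W, W y & W `<=` U]) ->
  T3_space Y.
Proof.
move=> Y1 Yb; split=> [y A|].
  move=> /=; rewrite {1}nbhsE => -[U [oU Uy] UA].
  have [W [oW cW Wy WU]] := Yb U y oU Uy.
  exists W; first by apply: open_nbhs_nbhs; split.
  by apply: subset_trans UA; rewrite -(closure_id W).1.
rewrite open_hausdorff => x y /eqP xy.
have [|W [oW cW Wx Wy]] := Yb (~` [set y]) x _ xy; first exact: closed_openC.
exists (W, ~` W) => /=; first by split; rewrite inE // => /Wy; exact.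
by split; [|exact: closed_openC|rewrite setICr].
Qed.

Lemma broom_T3 (I : choiceType) (a : I -> nat -> nat) : T3_space (broom a).
Proof.
apply: clopen_base_T3; first exact: closed_broom1.
move=> U [s|i] oU Uy.
  have [N UN] := oU s Uy; exists (fan a s N).
  split; [exact: open_fan|exact: closed_fan|exact: fan_node|].
  by move=> y /fanP[->//|[n Nn]]; exact: UN.
exists [set leaf a i]; split=> //; [exact: closed_broom1|by move=> _ ->].
Qed.

(** Choosing a member of the cover around each node gives a bound [N] beyond
which the cones are covered.  These countably many members contain every branch
that violates [N] at some node, and only countably many branches remain. *)
Lemma broom_lindelof (I : choiceType) (a : I -> nat -> nat) :
  (forall N, countable [set i | forall n, a i n < N (mkseq (a i) n)]) ->
  lindelof (broom a).
Proof.
move=> ca W oW covW.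
have Wof y : exists A, W A /\ A y.
  by have : [set: broom a] y by []; rewrite -covW => -[A]; exists A.
have [O OP] := choice Wof.
have fanO s : exists N, forall n, N <= n ->
    cylinder a (rcons s n) `<=` O (node a s).
  by have [WO Os] := OP (node a s); exact: (oW _ WO).
have [N NP] := choice fanO.
pose caught := [set i | forall n, a i n < N (mkseq (a i) n)].
exists (O @` (range (node a) `|` leaf a @` caught)); split.
- by move=> _ [y _ <-]; have [] := OP y.
- apply: (@sub_countable _ _ _ (range (node a) `|` leaf a @` caught)).
    exact: card_image_le.
  apply: countable_setU; first exact: (sub_countable (card_image_le _ _)).
  exact: (sub_countable (card_image_le _ _) (ca N)).
apply/seteqP; split=> // -[s _|i _].
  exists (O (node a s)); [by exists (node a s) => //; left; exists s|].
  by have [] := OP (node a s).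
have [ci|] := pselect (caught i).
  exists (O (leaf a i)); [by exists (leaf a i) => //; right; exists i|].
  by have [] := OP (leaf a i).
move=> /existsNP[n /negP]; rewrite -leqNgt => Nn.
exists (O (node a (mkseq (a i) n))).
  by exists (node a (mkseq (a i) n)) => //; left; eexists.
by apply: (NP _ _ Nn); rewrite -mkseqS; exact: cylinder_leaf.
Qed.

(** * Covering branches in trees of open sets *)

Lemma open_rect (X Y : topologicalType) (A : set X) (B : set Y) :
  open A -> open B -> open (A `*` B).
Proof.
move=> oA oB; rewrite openE => -[x y] [/= Ax By]; exists (A, B) => //=.
by split; apply: open_nbhs_nbhs; split.
Qed.

(** The tree [V] is a strategy of the player who chooses the covers in the
Menger game on [X], written with increasing covers, and a covering branch
defeats it.  The proof by contradiction rests on a closed subset [F] of the product with the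
broom: it has a point over every leaf, and none over a node. *)
Lemma productively_lindelof_covering_branch (X : topologicalType)
    (V : seq nat -> set X) :
  continuum_hypothesis -> productively_lindelof X ->
  (forall s, open (V s)) ->
  (forall s n m, n <= m -> V (rcons s n) `<=` V (rcons s m)) ->
  (forall s x, exists n, V (rcons s n) x) ->
  exists b : nat -> nat, \bigcup_n V (mkseq b n) = [set: X].
Proof.
move=> CH plX oV Vmono Vcov; apply: contrapT => noV.
have uncovered (b : nat -> nat) : exists x, forall n, ~ V (mkseq b n) x.
  apply: contrapT => nx; apply: noV; exists b; apply/seteqP; split=> // x _.
  by apply: contrapT => bx; apply: nx; exists x => n Vx; apply: bx; exists n.
have [a ca] := CH_escaping_family CH.
pose F : set (X * broom a) :=
  [set p | exists2 i, p.2 = leaf a i & forall n, ~ V (mkseq (a i) n) p.1].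
pose slice i : set (X * broom a) := setT `*` [set leaf a i].
pose W : set (set (X * broom a)) :=
  [set A | open A /\ (A `&` F = set0 \/ exists i, A = slice i)].
have [|| W' [W'W cW' covW']] := plX _ (broom_T3 a) (broom_lindelof ca) W.
- by move=> A [].
- apply/seteqP; split=> // -[x [s|i]] _; last first.
    exists (slice i) => //; split; last by right; exists i.
    by apply: open_rect; [exact: openT|exact: open_leaf].
  (* Above the successors [n >= N] of [s], every branch runs through a node
     whose open set contains the neighbourhood [V (rcons s N)] of [x]. *)
  have [N VN] := Vcov s x.
  exists (V (rcons s N) `*` fan a s N); last by split=> //; exact: fan_node.
  split; first by apply: open_rect; [exact: oV|exact: open_fan].
  left; apply/seteqP; split=> // -[x' y] [[/= Vx' fy] [i /= yi nVi]].
  move: fy; rewrite yi => /fanP[//|[n Nn /cylinder_leafP sni]].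
  by apply: (nVi (size (rcons s n))); rewrite sni; exact: Vmono Vx'.
have [x0 _] := uncovered (fun=> 0).
have slice_inj : injective slice.
  move=> i j ij; have : slice i (x0, leaf a i) by [].
  by rewrite ij => -[_ []].
have [i0 Wi0] : exists i, ~ W' (slice i).
  apply: contrapT => allW; apply: CH.1.
  apply: (sub_countable _ (countable_preimage_inj slice_inj cW')).
  apply: subset_card_le => i _ /=; apply: contrapT => nW.
  by apply: allW; exists i.
have [x nVx] := uncovered (a i0).
have : [set: X * broom a] (x, leaf a i0) by [].
rewrite -covW' => -[A W'A Ax]; have [_ [AF|[i Ai]]] := W'W _ W'A.
  suff : (A `&` F) (x, leaf a i0) by rewrite AF.
  by split=> //; exists i0.
by move: Ax W'A; rewrite Ai => -[_ [<-]].
Qed.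

(** * Locally finite sets of centres *)

Lemma lindelof_fst (X Y : topologicalType) (y : Y) :
  lindelof (X * Y)%type -> lindelof X.
Proof.
move=> lXY W oW covW; pose tube (A : set X) : set (X * Y) := A `*` setT.
have tube_inj : injective tube.
  move=> A B AB; apply/seteqP; split=> x Hx.
    by have : tube A (x, y) by []; rewrite AB => -[].
  by have : tube B (x, y) by []; rewrite -AB => -[].
have [|| W' [W'W cW' covW']] := lXY (tube @` W).
- by move=> _ [A WA <-]; apply: open_rect; [exact: oW|exact: openT].
- apply/seteqP; split=> // -[x z] _.
  have : [set: X] x by [].
  by rewrite -covW => -[A WA Ax]; exists (tube A) => //; exists A.
exists (tube @^-1` W'); split; last 2 first.
- exact: countable_preimage_inj.
- apply/seteqP; split=> // x _.
  have : [set: X * Y] (x, y) by [].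
  rewrite -covW' => -[B W'B Bx]; have [A WA AB] := W'W _ W'B.
  by exists A; [rewrite /= AB|move: Bx; rewrite -AB => -[]].
by move=> A /W'W[B WB /tube_inj <-].
Qed.

(** In a T1 space, deleting from a neighbourhood the finitely many points of [D]
other than [y] leaves a neighbourhood of [y]. *)
Lemma locally_finite_closed_discrete (X : topologicalType) (D : set X) :
  accessible_space X ->
  (forall y, exists U, [/\ open U, U y & finite_set (U `&` D)]) ->
  closed_discrete D.
Proof.
move=> T1 lfD.
have sep y : exists U, [/\ open U, U y & U `&` D `<=` [set y]].
  have [U [oU Uy fUD]] := lfD y.
  exists (U `&` ~` ((U `&` D) `\ y)); split.
  - apply: openI => //; apply: closed_openC.
    by apply: (accessible_finite_set_closed.1 T1); exact: finite_setD.
  - by split=> // -[_]; exact.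
  - by move=> z [[Uz nz] Dz]; apply: contrapT => zy; apply: nz.
split.
  rewrite -[D]setCK; apply: open_closedC; rewrite openE => y Dy.
  have [U [oU Uy UD]] := sep y; rewrite /interior nbhsE; exists U => // z Uz Dz.
  by apply: Dy; rewrite -(UD z).
move=> y Dy; split; first by rewrite inE.
have [U [oU Uy UD]] := sep y; exists U; first by apply: open_nbhs_nbhs; split.
by apply/seteqP; split=> // _ ->.
Qed.

(** Adding [U] itself to the neighbourhoods of the points outside [U] gives a
cover of the whole space; a countable subcover provides the centres, which are
then taken in finite batches. *)
Lemma lindelof_finite_exhaustion (X : topologicalType) (f : X -> set X)
    (U : set X) :
  lindelof X -> (forall x, open (f x) /\ f x x) -> open U ->
  exists E : nat -> set X,
    [/\ forall n, finite_set (E n), forall n, E n `<=` ~` U,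
        forall n m, n <= m -> E n `<=` E m &
        forall x, ~ U x -> exists n, (\bigcup_(z in E n) f z) x].
Proof.
move=> lX fP oU.
have [|| W' [W'W cW' covW']] := lX (U |` f @` (~` U)).
- by move=> A [->//|[x _ <-]]; have [] := fP x.
- apply/seteqP; split=> // x _; have [Ux|nUx] := pselect (U x).
    by exists U => //; left.
  by exists (f x); [right; exists x|have [] := fP x].
have /pcard_surjP[e esurj] := cW'.
(* [e] may enumerate [U] too, which need not have a centre: hence sets of at
   most one centre, rather than points. *)
have pick k : exists P : set X, [/\ finite_set P, P `<=` ~` U &
    (f @` ~` U) (e k) -> exists2 z, P z & f z = e k].
  have [[z nUz fz]|nfe] := pselect ((f @` (~` U)) (e k)); last first.
    by exists set0; split=> //; exact: finite_set0.
  by exists [set z]; split=> [|_ ->|_]; [exact: finite_set1| |exists z].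
have [P PP] := choice pick.
exists (fun n => \bigcup_(k in `I_n.+1) P k); split.
- by move=> n; apply: bigcup_finite => // k _; have [] := PP k.
- by move=> n z [k _ Pz]; have [_ + _] := PP k; exact.
- by move=> n m nm z [k kn Pz]; exists k => //; exact: leq_trans nm.
move=> x nUx; have : [set: X] x by [].
rewrite -covW' => -[A W'A Ax]; have [AU|fA] := W'W A W'A.
  by rewrite AU in Ax.
have [k _ ek] := esurj _ W'A; rewrite -ek in fA Ax.
have [_ _ /(_ fA)[z Pz fz]] := PP k.
by exists k; exists z; [exists k => /=|rewrite fz].
Qed.

Lemma mkseq_prefix_mono (T : Type) (A : seq nat -> set T) (b : nat -> nat) :
  (forall s n, A s `<=` A (rcons s n)) ->
  forall n m, n <= m -> A (mkseq b n) `<=` A (mkseq b m).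
Proof.
move=> AS n m /subnKC<-; elim: (m - n) => [|k IH]; first by rewrite addn0.
by rewrite addnS mkseqS; apply: subset_trans IH _; exact: AS.
Qed.

Theorem theorem2 :
  continuum_hypothesis ->
  forall X : topologicalType,
    T3_space X -> productively_lindelof X -> D_space X.
Proof.
move=> CH X [_ hX] plX f fP.
(* Any inhabited T3 Lindelof factor shows that [X] is Lindelof. *)
have [a ca] := CH_escaping_family CH.
have lX : lindelof X :=
  lindelof_fst (node a [::]) (plX _ (broom_T3 a) (broom_lindelof ca)).
pose cov (D : set X) := \bigcup_(x in D) f x.
have ocov D : open (cov D) by apply: bigcup_open => x _; have [] := fP x.
have covS D D' : D `<=` D' -> cov D `<=` cov D' by exact: bigcup_subset.
have [E EP] := choice (fun D => lindelof_finite_exhaustion lX fP (ocov D)).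
pose D s := foldl (fun D n => D `|` E D n) set0 s.
have DS s n : D (rcons s n) = D s `|` E (D s) n by rewrite /D foldl_rcons.
have finD s : finite_set (D s).
  elim/last_ind: s => [|s n IH]; first exact: finite_set0.
  by rewrite DS finite_setU; split=> //; have [] := EP (D s).
have [||| b covb] :=
  productively_lindelof_covering_branch (V := cov \o D) CH plX _ _ _.
- by move=> s; exact: ocov.
- move=> s n m nm; apply: covS; rewrite !DS; apply: setUS.
  by have [_ _ + _] := EP (D s); exact.
- move=> s x; have [sx|nsx] := pselect (cov (D s) x).
    by exists 0; apply: covS sx; rewrite DS; exact: subsetUl.
  have [_ _ _ /(_ x nsx)[n [z Ez fz]]] := EP (D s).
  by exists n; exists z => //; rewrite DS; right.
have Dmono : forall n m, n <= m -> D (mkseq b n) `<=` D (mkseq b m).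
  by apply: mkseq_prefix_mono => s n; rewrite DS; exact: subsetUl.
(* What is added after stage [n] lies outside the set covered at stage [n]. *)
have late n m : cov (D (mkseq b n)) `&` D (mkseq b m) `<=` D (mkseq b n).
  elim: m => [|m IH] z [cz]; first by [].
  have [/Dmono|nm] := leqP m.+1 n; first exact.
  rewrite mkseqS DS => -[Dz|Ez]; first exact: IH.
  have [_ /(_ _ _ Ez)+ _ _] := EP (D (mkseq b m)); case.
  by apply: covS cz; exact: Dmono.
exists (\bigcup_n D (mkseq b n)); split; last first.
  apply/seteqP; split=> // x _; have : [set: X] x by [].
  by rewrite -covb => -[n _ [z Dz fz]]; exists z => //; exists n.
apply: locally_finite_closed_discrete; first exact: hausdorff_accessible.
move=> y; have : [set: X] y by []; rewrite -covb => -[n _ cy].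
exists (cov (D (mkseq b n))); split=> //.
apply: (@sub_finite_set _ _ (D (mkseq b n))) => // z [cz [m _ Dz]].
by apply: late; split; [exact: cz|exact: Dz].
Qed.
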